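(* Let $t$ be a positive integer and $\overline{\mathcal D}=(\overline X,\overline{\mathcal B},\overline\rho)$ a $t$-divisible design such that (i) $\overline X$ is a finite set of points generating $\mathrm{PG}(d,q)$; (ii) all $\overline\rho$-transversal $t$-subsets of $\overline X$ are independent; (iii) all blocks span subspaces of the same dimension $\beta-1$. Let $c\ge0$, $n=d+c$, identify $\mathrm{PG}(d,q)$ with the subspace $x_{d+1}=\dots=x_n=0$ of $\mathrm{PG}(n,q)$, let $S$ be the subspace $x_0=\dots=x_d=0$, and let $G$ be the group of all matrices $\begin{pmatrix}I_{d+1}&M\\0&I_c\end{pmatrix}\in\mathrm{GL}_{n+1}(q)$, $M$ an arbitrary $(d+1)\times c$ matrix over $\mathbb F_q$, acting on points (row vectors) from the right. Let $X=\bigcup_{\overline x\in\overline X}\overline x^G$, $\mathcal B=\{\overline B^g\mid\overline B\in\overline{\mathcal B},g\in G\}$ and $\rho=\{(x,x')\in X\times X\mid (x^\pi,x'^\pi)\in\overline\rho\}$, where $\pi$ is the projection with centre $S$ onto $\mathrm{PG}(d,q)$; $(X,\mathcal B,\rho)$ is a $t$-divisible design (the $t$-lifting). Suppose that there is a group $\overline\Gamma$ of collineations of $\mathrm{PG}(d,q)$ which acts on $\overline X$ as an automorphism group of $\overline{\mathcal D}$, transitively on $\overline{\mathcal B}$ and transitively on the set of $\overline\rho$-transversal $t$-subsets of $\overline X$. Then $(X,\mathcal B,\rho)$ can also be obtained with Spera's construction; that is, it admits a group of automorphisms acting transitively on $\mathcal B$ and transitively on the set of $\rho$-transversal $t$-subsets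 of $X$.
   Context: A $t$-divisible design $(X,\mathcal B,\rho)$: $X$ finite, $\rho$ an equivalence relation (classes = point classes), a subset is $\rho$-transversal if it meets each class in at most one point; there are positive integers $s,k,\lambda_t$ with all blocks $\rho$-transversal $k$-subsets, all classes of size $s$, each $\rho$-transversal $t$-subset in exactly $\lambda_t$ blocks, and $t\le\#X/s$. An automorphism is a permutation of the point set mapping blocks onto blocks and point classes onto point classes. Spera's construction (A. G. Spera, 1992) builds a $t$-divisible design as the orbit of a base block under a group acting on a point set with an equivalence relation; a $t$-divisible design is obtainable this way iff it admits an automorphism group transitive on blocks and on transversal $t$-subsets. Points are independent if representing vectors are linearly independent. *)

(* Defs.v *)
From HB Require Import structures.
From mathcomp Require Import all_boot all_order all_algebra all_fingroup.

Set Implicit Arguments.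
Unset Strict Implicit.
Unset Printing Implicit Defensive.

Import GRing.Theory.

Local Open Scope ring_scope.

Section Designs.

Variable T : finType.

(* The data (X, B, rho); only the restriction of [drel] to [dpts] matters. *)
Record design_data := DesignData {
  dpts : {set T};
  dblocks : {set {set T}};
  drel : rel T
}.

Variables (t : nat) (D : design_data).

Definition point_classes : {set {set T}} :=
  equivalence_partition (drel D) (dpts D).

Definition rho_transversal (Y : {set T}) : bool :=
  (Y \subset dpts D) &&
  [forall C in point_classes, (#|Y :&: C| <= 1)%N].

Definition transversal_subsets : {set {set T}} :=
  [set Y : {set T} | rho_transversal Y && (#|Y| == t)].

Record is_divisible_design_with (s k lambda : nat) : Prop := {
  dd_equiv : {in dpts D & &, equivalence_rel (drel D)};
  dd_t_gt0 : (0 < t)%N;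
  dd_s_gt0 : (0 < s)%N;
  dd_k_gt0 : (0 < k)%N;
  dd_lambda_gt0 : (0 < lambda)%N;
  dd_block : forall B, B \in dblocks D -> rho_transversal B /\ #|B| = k;
  dd_class : forall C, C \in point_classes -> #|C| = s;
  dd_lambda : forall Y, Y \in transversal_subsets ->
    #|[set B in dblocks D | Y \subset B]| = lambda;
  dd_t_le : (t <= #|dpts D| %/ s)%N
}.

Definition is_divisible_design : Prop :=
  exists s k lambda : nat, is_divisible_design_with s k lambda.

(* A permutation of the ambient type acting on X as an automorphism.  As every
   permutation of X extends to one of T, quantifying over groups of such
   permutations amounts to quantifying over automorphism groups of D. *)
Definition acts_as_automorphism (g : {perm T}) : Prop :=
  [/\ g @: dpts D = dpts D,
      [set g @: B | B : {set T} in dblocks D] = dblocks D &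
      [set g @: C | C : {set T} in point_classes] = point_classes].

Definition transitive_automorphism_group (Gam : {group {perm T}}) : Prop :=
  [/\ {in Gam, forall g, acts_as_automorphism g},
      [transitive Gam, on dblocks D | 'P^*] &
      [transitive Gam, on transversal_subsets | 'P^*]].

(* Spera's construction takes the orbit of a base block under a group of
   permutations; a t-divisible design arises in this way if and only if it
   admits a group as below. *)
Definition obtainable_by_Spera : Prop :=
  is_divisible_design /\
  exists Gam : {group {perm T}}, transitive_automorphism_group Gam.

End Designs.

Section Projective.

Variable F : finFieldType.

(* Points of PG(m - 1, q), q = #|F|: the 1-dimensional subspaces of 'rV[F]_m,
   each given by the canonical square matrix <<_>> of its row space. *)
Definition is_point m (P : 'M[F]_m) : bool :=
  (<<P>>%MS == P) && (\rank P == 1)%N.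

Record point m := Point { point_mx :> 'M[F]_m; _ : is_point point_mx }.

HB.instance Definition _ m := [isSub for @point_mx m].
HB.instance Definition _ m := [Finite of point m by <:].

Definition rep_vector m (x : point m) : 'rV[F]_m := nz_row x.

Definition independent m (Y : {set point m}) : bool :=
  free [seq rep_vector x | x <- enum Y].

Definition span_pts m (Y : {set point m}) : 'M[F]_m :=
  (\sum_(x in Y) (x : 'M_m))%MS.

Fact image_subproof m n (A : 'M[F]_(m, n)) (x : point m) :
  row_free A -> is_point <<x *m A>>%MS.
Proof.
move=> Afree; case: x => P /= /andP[_ rP].
by rewrite /is_point genmx_id eqxx /= genmxE mxrankMfree.
Qed.

Definition image_pt m n (A : 'M[F]_(m, n)) (Afree : row_free A)
  (x : point m) : point n := Point (image_subproof x Afree).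

Fact GL_row_free n (g : {'GL_n.+1[F]}) : row_free (GLval g).
Proof. by rewrite row_free_unit; exact: GL_unit. Qed.

Definition GLact n (g : {'GL_n.+1[F]}) (x : point n.+1) : point n.+1 :=
  image_pt (GL_row_free g) x.

Definition flat_pts m (L : 'M[F]_m) : {set point m} :=
  [set x : point m | (x <= L)%MS].

Definition semilinear_perm m (s : {perm point m}) : Prop :=
  exists (theta : {rmorphism F -> F}) (A : 'M[F]_m),
    A \in unitmx /\
    forall x : point m, (s x : 'M_m) = <<map_mx theta x *m A>>%MS.

(* A collineation is a permutation of the points that maps lines to lines.  On
   a projective line every permutation does so; there, as usual, only the
   permutations induced by semilinear bijections are collineations. *)
Definition collineation m (s : {perm point m}) : Prop :=
  (forall L : 'M[F]_m, \rank L = 2%N ->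
     exists2 L' : 'M[F]_m, \rank L' = 2%N & s @: flat_pts L = flat_pts L')
  /\ (m = 2%N -> semilinear_perm s).

End Projective.

Section Lifting.

Variables (F : finFieldType) (d c : nat).

(* PG(d, q) is [point F d.+1] and PG(d + c, q) is [point F (d.+1 + c)]. *)

Definition base_mx : 'M[F]_(d.+1, d.+1 + c) := row_mx 1%:M 0.
Definition centre_mx : 'M[F]_(c, d.+1 + c) := row_mx 0 1%:M.

Fact base_mx_free : row_free base_mx.
Proof. by apply/row_freeP; exists (col_mx 1%:M 0);
  rewrite mul_row_col mul1mx mul0mx addr0. Qed.

Definition embed : point F d.+1 -> point F (d.+1 + c) :=
  image_pt base_mx_free.

Definition lift_group : {set {'GL_(d.+1 + c)[F]}} :=
  [set g : {'GL_(d.+1 + c)[F]} | [exists M : 'M[F]_(d.+1, c),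
     (GLval g : 'M[F]_(d.+1 + c)) == block_mx 1%:M M 0 1%:M]].

(* [projects x y]: the projection of x from the centre S exists and is y. *)
Definition projects (x : point F (d.+1 + c)) (y : point F d.+1) : bool :=
  (embed y == (x + centre_mx) :&: base_mx)%MS.

Variable D : design_data (point F d.+1).

Definition lift_pts : {set point F (d.+1 + c)} :=
  \bigcup_(x in dpts D) [set GLact g (embed x) | g in lift_group].

Definition lift_blocks : {set {set point F (d.+1 + c)}} :=
  [set GLact g @: (embed @: (B : {set point F d.+1})) |
     B in dblocks D, g in lift_group].

Definition lift_rel : rel (point F (d.+1 + c)) := fun x x' =>
  [&& x \in lift_pts, x' \in lift_pts &
   [exists y, exists y', [&& projects x y, projects x' y' & drel D y y']]].

Definition lifting : design_data (point F (d.+1 + c)) :=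
  DesignData lift_pts lift_blocks lift_rel.

End Lifting.

(* Main.v *)
Require Import Defs.
From HB Require Import structures.
From mathcomp Require Import all_boot all_order all_algebra all_fingroup.

Set Implicit Arguments.
Unset Strict Implicit.
Unset Printing Implicit Defensive.

Import GRing.Theory.

Local Open Scope ring_scope.

(** A point x of X has the form <(v, w)> with <v> in Xbar, so that each map
    y |-> <y (1 M)> is a section of the projection, and the blocks of the
    lifting are the images of the blocks of Dbar under these sections.  As
    transversal t-subsets of Xbar are independent, any lift of such a subset is
    also its image under one of the sections.  By the fundamental theorem of
    projective geometry each collineation of Gambar is induced by some
    v |-> theta(v) A; the maps (v, w) |-> (theta(v) A, theta(v) N + theta(w))
    lift it to automorphisms of the lifting, permute the sections, and with N
    arbitrary send any given section to any other one.  So the full automorphism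
    group of the lifting is transitive on blocks and on transversal t-subsets;
    this also shows that the number of blocks through a transversal t-subset is
    constant. *)

(** * Lines spanned by row vectors, and comparison of coefficients *)

Section RowSpans.

Variables (F : fieldType) (m : nat).
Implicit Types u v w x y z : 'rV[F]_m.

Lemma sub_add_rVP w u v :
  reflect (exists a b, w = a *: u + b *: v) (w <= u + v)%MS.
Proof.
apply: (iffP sub_addsmxP) => [[[a b] /= ->]|[a [b ->]]].
  by exists (a 0 0), (b 0 0); rewrite -!mul_scalar_mx -!mx11_scalar.
by exists (a%:M, b%:M); rewrite /= !mul_scalar_mx.
Qed.

Lemma coef2 x y : x != 0 -> ~~ (y <= x)%MS ->
  forall a b a' b', a *: x + b *: y = a' *: x + b' *: y -> a = a' /\ b = b'.
Proof.
move=> x0 yx a b a' b' e.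
have {}e : (a - a') *: x = (b' - b) *: y.
  by rewrite !scalerBl; apply/eqP; rewrite subr_eq addrAC eq_sym subr_eq e addrC.
have bb : b' - b = 0.
  apply: contraNeq yx => nz; apply/sub_rVP; exists ((b' - b)^-1 * (a - a')).
  by rewrite -scalerA e scalerA mulVf ?scale1r.
move: e; rewrite bb scale0r => /eqP; rewrite scaler_eq0 (negPf x0) orbF subr_eq0.
by move/eqP=> ->; split=> //; apply/esym/eqP; rewrite -subr_eq0 bb.
Qed.

Lemma coef3 x y z : x != 0 -> ~~ (y <= x)%MS -> ~~ (z <= x + y)%MS ->
  forall a b c a' b' c',
    a *: x + b *: y + c *: z = a' *: x + b' *: y + c' *: z ->
  [/\ a = a', b = b' & c = c'].
Proof.
move=> x0 yx zxy a b c a' b' c' e.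
have {}e' : (a - a') *: x + (b - b') *: y = (c' - c) *: z.
  rewrite !scalerBl; apply/eqP; rewrite addrACA -opprD subr_eq.
  by rewrite addrAC eq_sym subr_eq e addrC.
have cc : c' - c = 0.
  apply: contraNeq zxy => nz; apply/sub_add_rVP.
  exists ((c' - c)^-1 * (a - a')), ((c' - c)^-1 * (b - b')).
  by rewrite -!scalerA -scalerDr e' scalerA mulVf ?scale1r.
have cE : c = c' by apply/esym/eqP; rewrite -subr_eq0 cc.
rewrite cE in e; move/addIr: e => e.
by have [-> ->] := coef2 x0 yx e.
Qed.

Lemma sub_rV_sym u v : u != 0 -> (u <= v)%MS -> (v <= u)%MS.
Proof.
move=> u0 /sub_rVP[a e]; have a0 : a != 0.
  by apply: contraNneq u0 => a0; rewrite e a0 scale0r.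
by apply/sub_rVP; exists a^-1; rewrite e scalerA mulVf ?scale1r.
Qed.

Lemma sub_rV0 u : (u <= (0 : 'rV[F]_m))%MS = (u == 0).
Proof.
apply/sub_rVP/eqP => [[a ->]|->]; first by rewrite scaler0.
by exists 0; rewrite scaler0.
Qed.

Lemma rank_add_rV u v : u != 0 -> ~~ (v <= u)%MS -> \rank (u + v)%MS = 2%N.
Proof.
move=> u0 vu; apply/eqP; rewrite eqn_leq; apply/andP; split.
  apply: leq_trans (mxrank_adds_leqif u v) _.
  exact: leq_add (rank_leq_row u) (rank_leq_row v).
have : (u < u + v)%MS.
  by rewrite ltmxE addsmxSl addsmx_sub submx_refl.
by rewrite ltmxErank => /andP[_]; rewrite rank_rV u0.
Qed.

End RowSpans.

(** * The fundamental theorem of projective geometry, in projective dimension at least two *)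

(* The hypothesis [fP] says that f induces an injective map of points that
   preserves and reflects the incidence of points with lines. *)
Section FundamentalTheorem.

Variables (F : finFieldType) (k : nat).
Local Notation n := k.+2.
Variable f : 'rV[F]_(1 + n) -> 'rV[F]_(1 + n).
Hypothesis f0 : f 0 = 0.
Hypothesis fP : forall u v w, (w <= u + v)%MS = (f w <= f u + f v)%MS.

(** The space is split as the line of [E] plus the hyperplane of the vectors [I h]. The point of [E]
    serves as origin, against which representatives of the images of hyperplane points are
    scaled. *)
Local Notation E := (row_mx 1%:M 0 : 'rV[F]_(1 + n)).
Local Notation I h := (row_mx 0 h : 'rV[F]_(1 + n)).

Let fP1 v w : (w <= v)%MS = (f w <= f v)%MS.
Proof.
have e (u : 'rV[F]_(1 + n)) : ((u + u)%MS :=: u)%MS by apply/addsmx_idPl.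
by rewrite -(e v) fP e.
Qed.

Let f_eq0 w : (f w == 0) = (w == 0).
Proof. by rewrite -!sub_rV0 [RHS]fP1 f0. Qed.

Let rowE a (h : 'rV[F]_n) : row_mx a%:M h = a *: E + I h.
Proof.
rewrite scale_row_mx add_row_mx scaler0 addr0 add0r.
by rewrite scale_scalar_mx mulr1.
Qed.

Let ID h h' : I (h + h') = I h + I h'.
Proof. by rewrite add_row_mx addr0. Qed.

Let IZ a h : I (a *: h) = a *: I h.
Proof. by rewrite scale_row_mx scaler0. Qed.

Let I_inj h h' : I h = I h' -> h = h'.
Proof. by case/eq_row_mx. Qed.

Let I_eq0 h : (I h == 0) = (h == 0).
Proof. by rewrite row_mx_eq0 eqxx. Qed.

Let EI_inj a h b h' : a *: E + I h = b *: E + I h' -> a = b /\ h = h'.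
Proof.
rewrite -!rowE => /eq_row_mx[/matrixP/(_ 0 0) e ->]; split => //.
by move: e; rewrite !mxE eqxx !mulr1n.
Qed.

Let E_neq0 : E != 0.
Proof. by rewrite row_mx_eq0 eqxx andbT -mxrank_eq0 mxrank1. Qed.

Let I_notin_E h : h != 0 -> ~~ (I h <= E)%MS.
Proof.
move=> h0; apply/negP => /sub_rVP[a e].
have /EI_inj[_ e0] : 0 *: E + I h = a *: E + I 0.
  by rewrite scale0r add0r e row_mx0 addr0.
by rewrite e0 eqxx in h0.
Qed.

Let I_sub h h' : (I h <= I h')%MS = (h <= h')%MS.
Proof.
apply/sub_rVP/sub_rVP => -[a e]; exists a.
  by apply: I_inj; rewrite e IZ.
by rewrite e IZ.
Qed.

Let I_notin_EI h h' : ~~ (h' <= h)%MS -> ~~ (I h' <= E + I h)%MS.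
Proof.
apply: contraNN => /sub_add_rVP[a [b e]]; apply/sub_rVP; exists b.
have /EI_inj[_ e0] : 0 *: E + I h' = a *: E + I (b *: h).
  by rewrite scale0r add0r e IZ.
by [].
Qed.

Let e' := f E.

Let e'_neq0 : e' != 0. Proof. by rewrite f_eq0. Qed.

(* [lift_at h y]: y is the representative of the image of <(0, h)> whose
   scaling is fixed by the requirement that e' + y represents the image of
   <(1, h)>. *)
Let lift_at (h : 'rV[F]_n) (y : 'rV[F]_(1 + n)) :=
  (exists2 a, a != 0 & y = a *: f (I h)) /\
  (exists2 a, a != 0 & f (E + I h) = a *: (e' + y)).

(** The point <(1, h)> lies on the line through [E] and [I h], so [f (E + I h)] is a combination of
    [e'] and [f (I h)]. Both coefficients are nonzero, since otherwise <(1, h)> would share its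
    image with one of these two points; dividing by the first one gives y. *)
Let lift_at_ex h : exists y, lift_at h y.
Proof.
have [-> | h0] := eqVneq h 0.
  exists 0; rewrite /lift_at row_mx0 f0 !addr0; split; exists 1 => //.
  - exact: oner_neq0.
  - by rewrite scaler0.
  - exact: oner_neq0.
  - by rewrite scale1r.
have : (f (E + I h)%R <= f E + f (I h))%MS.
  by rewrite -fP; apply/sub_add_rVP; exists 1, 1; rewrite !scale1r.
case/sub_add_rVP => a [b e].
have a0 : a != 0.
  apply/eqP => a0; have : ((E + I h)%R <= I h)%MS.
    by rewrite fP1 e a0 scale0r add0r scalemx_sub.
  case/sub_rVP => x; rewrite -IZ -[E in LHS]scale1r => ex.
  have /EI_inj[/eqP] : 1 *: E + I h = 0 *: E + I (x *: h).
    by rewrite ex scale0r add0r.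
  by rewrite oner_eq0.
have b0 : b != 0.
  apply/eqP => b0; have : ((E + I h)%R <= E)%MS.
    by rewrite fP1 e b0 scale0r addr0 scalemx_sub.
  case/sub_rVP => x; rewrite -[E in LHS]scale1r => ex.
  have /EI_inj[_ e0] : 1 *: E + I h = x *: E + I 0.
    by rewrite ex row_mx0 addr0.
  by rewrite e0 eqxx in h0.
exists ((a^-1 * b) *: f (I h)); split.
  by exists (a^-1 * b); rewrite // mulf_neq0 ?invr_eq0.
exists a => //; rewrite scalerDr scalerA mulrA mulfV // mul1r.
exact: e.
Qed.

Let lift_at_uniq h y z : lift_at h y -> lift_at h z -> y = z.
Proof.
have [-> | h0] := eqVneq h 0.
  by case=> [[a _ ->] _] [[b _ ->] _]; rewrite row_mx0 f0 !scaler0.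
case=> [[a a0 ->] [b b0 eb]] [[c c0 ->] [g g0]]; rewrite eb.
have nE : ~~ (f (I h) <= e')%MS by rewrite -fP1 I_notin_E.
by rewrite !scalerDr !scalerA => /(coef2 e'_neq0 nE)[<- /(mulfI b0) ->].
Qed.

(** The normalised representatives [T h] are additive and satisfy T(a h) = theta(a) T(h) with
    theta(a) independent of h. Additivity comes first for independent vectors, then theta is
    constructed, and the dependent case follows from additivity of theta. *)
Lemma line_map_semilinear :
  exists (theta : {rmorphism F -> F}) (A : 'M[F]_(1 + n)),
  A \in unitmx /\ forall v, (f v :=: map_mx theta v *m A)%MS.
Proof.
have [T TP] : exists T : 'rV[F]_n -> 'rV[F]_(1 + n), forall h, lift_at h (T h).
  exact: fin_all_exists lift_at_ex.
have T0 : T 0 = 0 by case: (TP 0) => [[a _ ->] _]; rewrite row_mx0 f0 scaler0.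
have TI h : exists2 a, a != 0 & T h = a *: f (I h) by case: (TP h).
have TE h : exists2 a, a != 0 & f (E + I h) = a *: (e' + T h) by case: (TP h).
have TIeq h : (T h :=: f (I h))%MS.
  by have [a a0 ->] := TI h; apply: eqmx_scale.
have T_eq0 h : (T h == 0) = (h == 0).
  by rewrite -sub_rV0 TIeq sub_rV0 f_eq0 I_eq0.
have T_sub h h' : (T h <= T h')%MS = (h <= h')%MS.
  by rewrite !TIeq -fP1 I_sub.
have nTe h : h != 0 -> ~~ (T h <= e')%MS.
  by move=> h0; rewrite TIeq -fP1 I_notin_E.
have nTeT h h' : ~~ (h' <= h)%MS -> ~~ (T h' <= e' + T h)%MS.
  by move=> hh; rewrite TIeq (adds_eqmx (eqmx_refl e') (TIeq h)) -fP I_notin_EI.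
(* <(1, u + v)> and <(0, u + v)> are intersections of lines spanned by points
   on which T is already controlled. *)
have TD_indep u v : u != 0 -> ~~ (v <= u)%MS -> T (u + v) = T u + T v.
  move=> u0 vu; have cf := coef3 e'_neq0 (nTe _ u0) (nTeT _ _ vu).
  have [a1 [b1 e1]] : exists a b, f (E + I (u + v)) = a *: (e' + T u) + b *: T v.
    have [c c0 ec] := TE u; have [g g0 eg] := TI v.
    have : (f (E + I (u + v))%R <= f (E + I u)%R + f (I v))%MS.
      by rewrite -fP; apply/sub_add_rVP; exists 1, 1; rewrite !scale1r ID addrA.
    case/sub_add_rVP => a [b ->]; exists (a * c), (b / g).
    by rewrite ec eg !scalerA divfK.
  have [a2 [b2 e2]] : exists a b, f (E + I (u + v)) = a *: (e' + T v) + b *: T u.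
    have [c c0 ec] := TE v; have [g g0 eg] := TI u.
    have : (f (E + I (u + v))%R <= f (E + I v)%R + f (I u))%MS.
      rewrite -fP; apply/sub_add_rVP; exists 1, 1; rewrite !scale1r ID -addrA.
      by rewrite (addrC (I v)).
    case/sub_add_rVP => a [b ->]; exists (a * c), (b / g).
    by rewrite ec eg !scalerA divfK.
  (* The two expressions, compared in the independent vectors [e'], [T u], [T v], force equal
     coefficients, so [f (E + I (u + v))] is a multiple of [e' + T u + T v]. *)
  have ab1 : b1 = a1.
    by move: e1; rewrite e2 !scalerDr addrAC => /cf[<- _ ->].
  rewrite {b1}ab1 -scalerDr -addrA in e1.
  have a10 : a1 != 0.
    have: f (E + I (u + v)) != 0.
      rewrite f_eq0; apply/eqP => ex.
      have /EI_inj[/eqP] : 1 *: E + I (u + v) = 0 *: E + I 0.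
        by rewrite scale1r ex scale0r row_mx0 addr0.
      by rewrite oner_eq0.
    by rewrite e1; apply: contraNneq => ->; rewrite scale0r.
  have [p [q ep]] : exists p q, f (I (u + v)) = p *: T u + q *: T v.
    have : (f (I (u + v)%R) <= f (I u) + f (I v))%MS.
      by rewrite -fP; apply/sub_add_rVP; exists 1, 1; rewrite !scale1r ID.
    by rewrite -(adds_eqmx (TIeq u) (TIeq v)) => /sub_add_rVP.
  have [r [s er]] : exists r s, f (I (u + v)) = r *: (e' + (T u + T v)) + s *: e'.
    have : (f (I (u + v)) <= f (E + I (u + v)) + f E)%MS.
      rewrite -fP; apply/sub_add_rVP; exists 1, (-1).
      by rewrite scale1r scaleN1r addrAC subrr add0r.
    case/sub_add_rVP => a [b ->]; exists (a * a1), b.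
    by rewrite e1 scalerA.
  (* The point <(0, u + v)> is where the line of <(0, u)> and <(0, v)> meets the line of <(1, u +
     v)> and [E]; hence its image is spanned by [T u + T v]. *)
  have pq : p = q.
    have : 0 *: e' + p *: T u + q *: T v = (r + s) *: e' + r *: T u + r *: T v.
      rewrite scale0r add0r -ep er !scalerDr scalerDl.
      by rewrite !addrA (addrAC _ (r *: T v)) (addrAC _ (r *: T u)).
    by case/cf=> _ -> ->.
  rewrite -pq -scalerDr in ep.
  have p0 : p != 0.
    have: f (I (u + v)) != 0.
      rewrite f_eq0 I_eq0 addrC addr_eq0; apply: contraNneq vu => ->.
      by rewrite eqmx_opp.
    by rewrite ep; apply: contraNneq => ->; rewrite scale0r.
  apply: (@lift_at_uniq (u + v)) => //; split; last by exists a1.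
  by exists p^-1; rewrite ?invr_eq0 // ep scalerA mulVf ?scale1r.
have TZ_ex a h : exists c, T (a *: h) = c *: T h.
  by apply/sub_rVP; rewrite T_sub scalemx_sub.
(* Expanding T(a (u + v)) in two ways shows that independent u and v share the scalar attached to
   a. *)
have TZ_indep a c u v : u != 0 -> ~~ (v <= u)%MS ->
    T (a *: u) = c *: T u -> T (a *: v) = c *: T v.
  move=> u0 vu eu; have [a0 | a0] := eqVneq a 0.
    move: eu => /esym/eqP; rewrite a0 !scale0r T0 scaler_eq0 T_eq0 (negPf u0).
    by rewrite orbF => /eqP->; rewrite scale0r.
  have [b eb] := TZ_ex a v; have [g eg] := TZ_ex a (u + v).
  have au0 : a *: u != 0 by rewrite scaler_eq0 negb_or a0.
  have avu : ~~ (a *: v <= a *: u)%MS by rewrite !eqmx_scale.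
  move: eg; rewrite scalerDr (TD_indep _ _ au0 avu) (TD_indep _ _ u0 vu).
  rewrite eu eb scalerDr => /coef2[]; rewrite ?T_eq0 ?T_sub //.
  by move=> -> ->.
(* Two independent vectors of the hyperplane exist because n is at least 2. The scalar is read off
   at [h0]; multiples of [h0] are compared with [h1] instead. *)
pose h0 : 'rV[F]_n := delta_mx 0 0; pose h1 : 'rV[F]_n := delta_mx 0 1.
have h0_neq0 : h0 != 0.
  by apply/eqP => /matrixP/(_ 0 0)/eqP; rewrite !mxE !eqxx oner_eq0.
have h1h0 : ~~ (h1 <= h0)%MS.
  apply/negP => /sub_rVP[a /matrixP/(_ 0 1)/eqP].
  by rewrite !mxE /= mulr0 oner_eq0.
have h1_neq0 : h1 != 0 by apply: contraNneq h1h0 => ->; apply: sub0mx.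
have [th0 thP0] := fin_all_exists (fun a => TZ_ex a h0).
have thP1 a : T (a *: h1) = th0 a *: T h1 by apply: (TZ_indep _ _ h0).
have TZ a h : T (a *: h) = th0 a *: T h.
  have [/sub_rVP[c ->]|hh] := boolP (h <= h0)%MS; last exact: (TZ_indep _ _ h0).
  have [->|c0] := eqVneq c 0; first by rewrite scale0r scaler0 T0 scaler0.
  apply: (TZ_indep _ _ h1) => //; apply: contraNN h1h0 => ch.
  apply: submx_trans (sub_rV_sym _ ch) (scalemx_sub _ (submx_refl _)).
  by rewrite scaler_eq0 negb_or c0.
have th_inj a b h : h != 0 -> a *: T h = b *: T h -> a = b.
  move=> hn /eqP; rewrite -subr_eq0 -scalerBl scaler_eq0 T_eq0 (negPf hn) orbF.
  by rewrite subr_eq0 => /eqP.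
have th1 : th0 1 = 1.
  by apply: (th_inj _ _ h0) => //; rewrite -TZ !scale1r.
have thM : {morph th0 : a b / a * b}.
  by move=> a b; apply: (th_inj _ _ h0) => //; rewrite -TZ -!scalerA -!TZ.
have TD_scaled a b h v : v != 0 -> ~~ (h <= v)%MS ->
    T (a *: h + b *: v) = th0 a *: T h + th0 b *: T v.
  move=> v0 hv; rewrite -!TZ.
  have [->|a0] := eqVneq a 0; first by rewrite scale0r T0 !add0r.
  have [->|b0] := eqVneq b 0; first by rewrite scale0r T0 !addr0.
  have bv0 : b *: v != 0 by rewrite scaler_eq0 negb_or b0.
  have ahbv : ~~ (a *: h <= b *: v)%MS by rewrite !eqmx_scale.
  by rewrite addrC (TD_indep _ _ bv0 ahbv) addrC.
have th00 : th0 0 = 0.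
  by apply: (th_inj _ _ h0) => //; rewrite -TZ !scale0r T0.
(* Additivity of T is so far known only for independent vectors, so [h1] is added to one of two
   multiples of [h0] and cancelled at the end. *)
have thD : {morph th0 : a b / a + b}.
  move=> a b; have [->|a0] := eqVneq a 0; first by rewrite th00 !add0r.
  have ah0 : a *: h0 != 0 by rewrite scaler_eq0 negb_or a0.
  have nb : ~~ ((b *: h0 + 1 *: h1)%R <= a *: h0)%MS.
    rewrite eqmx_scale //; apply: contraNN h1h0 => hb.
    have -> : h1 = (b *: h0 + 1 *: h1)%R - b *: h0.
      by rewrite scale1r addrAC subrr add0r.
    by rewrite addmx_sub // eqmx_opp scalemx_sub.
  have e : T (a *: h0 + (b *: h0 + 1 *: h1)) = T (1 *: h1 + (a + b) *: h0).
    by rewrite addrA -scalerDl addrC.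
  move: e; rewrite (TD_indep _ _ ah0 nb).
  rewrite (addrC (b *: h0)) !TD_scaled // TZ addrCA => /addrI.
  by rewrite -scalerDl => /th_inj ->.
have TD : {morph T : u v / u + v}.
  move=> u v; have [->|u0] := eqVneq u 0; first by rewrite T0 !add0r.
  have [/sub_rVP[c ->]|] := boolP (v <= u)%MS; last exact: TD_indep.
  by rewrite -{1}[u]scale1r -scalerDl !TZ thD scalerDl th1 scale1r.
have thB : zmod_morphism th0.
  move=> a b; apply/eqP; rewrite eq_sym subr_eq -thD subrK; exact/eqP.
pose theta : {rmorphism F -> F} := HB.pack th0
  (GRing.isZmodMorphism.Build F F th0 thB)
  (GRing.isMonoidMorphism.Build F F th0 (conj th1 thM)).
pose A : 'M[F]_(1 + n) := col_mx e' (\matrix_i T (delta_mx 0 i)).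
have AP (a : F) h : map_mx theta (row_mx a%:M h) *m A = theta a *: e' + T h.
  rewrite map_row_mx mul_row_col map_scalar_mx mul_scalar_mx; congr (_ + _).
  rewrite [in RHS](row_sum_delta h) (big_morph T TD T0) mulmx_sum_row.
  by apply: eq_bigr => i _; rewrite rowK mxE TZ.
(* If the first coordinate a is nonzero, dividing by it keeps the point and reduces to the
   normalised case [E + I h]. *)
have fA v : (f v :=: map_mx theta v *m A)%MS.
  rewrite -(hsubmxK v) (mx11_scalar (lsubmx v)); set a := lsubmx v 0 0.
  move: (rsubmx v) => h; rewrite AP rowE.
  have [->|a0] := eqVneq a 0.
    by rewrite rmorph0 !scale0r !add0r; apply: eqmx_sym.
  have -> : a *: E + I h = a *: (E + I (a^-1 *: h)).
    by rewrite IZ scalerDr scalerA mulfV // scale1r.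
  have fZ w : (f (a *: w) :=: f w)%MS.
    by apply/eqmxP; rewrite -!fP1 !eqmx_scale // !submx_refl.
  have [g g0 eg] := TE (a^-1 *: h).
  apply: eqmx_trans (fZ _) _; rewrite eg TZ.
  have -> : theta a *: e' + T h = theta a *: (e' + theta a^-1 *: T h).
    by rewrite scalerDr scalerA -rmorphM mulfV // rmorph1 scale1r.
  apply: eqmx_trans (eqmx_scale _ g0) (eqmx_sym (eqmx_scale _ _)).
  by rewrite fmorph_eq0.
exists theta, A; split=> //; rewrite -row_free_unit; apply: inj_row_free => u uA.
(* As F is finite, theta is bijective, so a row vector killed by A is the theta-image of a vector
   whose f-image is 0. *)
have [thI _ thIK] : bijective theta by apply: injF_bij; apply: fmorph_inj.
have uE : u = map_mx theta (map_mx thI u).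
  by apply/matrixP => i j; rewrite !mxE thIK.
have : f (map_mx thI u) == 0 by rewrite -sub_rV0 fA -uE uA submx_refl.
by rewrite f_eq0 => /eqP e; rewrite uE e map_mx0.
Qed.

End FundamentalTheorem.

(** * Points and their representing vectors *)

Section Points.

Variables (F : finFieldType) (m : nat).
Implicit Types x y : point F m.

Lemma rank_point x : \rank x = 1%N.
Proof. by case: x => P /= /andP[_ /eqP]. Qed.

Lemma point_gen x : <<x>>%MS = x.
Proof. by case: x => P /= /andP[/eqP]. Qed.

(** Both spaces have rank 1, and the canonical form [<<_>>] turns equality of row spaces into
    equality of matrices. *)
Lemma point_sub x y : (x <= y)%MS -> x = y.
Proof.
move=> xy; apply: val_inj; rewrite /= -point_gen -[RHS]point_gen.
by apply/genmxP; rewrite -(mxrank_leqif_eq xy) !rank_point.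
Qed.

Lemma point_subE x y : (x <= y)%MS = (x == y).
Proof. by apply/idP/eqP => [/point_sub | ->]. Qed.

Lemma rep_vector_neq0 x : rep_vector x != 0.
Proof. by rewrite nz_row_eq0 -mxrank_eq0 rank_point. Qed.

Lemma rep_vectorE x : (rep_vector x :=: x)%MS.
Proof.
apply/eqmxP; rewrite -(mxrank_leqif_eq (nz_row_sub _)).
by rewrite rank_rV rep_vector_neq0 rank_point.
Qed.

Fact rowV_point_subproof (v : 'rV[F]_m) : v != 0 -> is_point <<v>>%MS.
Proof. by move=> v0; rewrite /is_point genmx_id eqxx /= genmxE rank_rV v0. Qed.

Definition rowV_point (v : 'rV[F]_m) (v0 : v != 0) : point F m :=
  Point (rowV_point_subproof v0).

Lemma rowV_pointE (v : 'rV[F]_m) (v0 : v != 0) : (rowV_point v0 :=: v)%MS.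
Proof. exact: genmxE. Qed.

End Points.

(** * Collineations are induced by semilinear bijections *)

Section Collineations.

Variable F : finFieldType.

(** Provides the map of vectors on which [line_map_semilinear] operates: a representative of each
    image point is chosen arbitrarily, with no compatibility between choices. *)
Lemma perm_vector_lift m (s : {perm point F m}) :
  exists2 f : 'rV[F]_m -> 'rV[F]_m, f 0 = 0 &
    forall (x : point F m) v, (x == v)%MS -> (s x == f v)%MS.
Proof.
have [|f fP] := @fin_all_exists 'rV[F]_m (fun=> 'rV[F]_m) (fun v w =>
    (v = 0 -> w = 0) /\ forall x : point F m, (x == v)%MS -> (s x == w)%MS).
  move=> v; have [-> | v0] := eqVneq v 0.
    exists 0; split=> // x /eqmxP ex; have := rank_point x.
    by rewrite ex mxrank0.
  exists (rep_vector (s (rowV_point v0))); split=> [e|x /eqmxP ex].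
    by case/eqP: (v0).
  have -> : x = rowV_point v0 by apply: point_sub; rewrite ex rowV_pointE.
  by apply/eqmxP; apply: eqmx_sym; apply: rep_vectorE.
by exists f => [|x v]; [case: (fP 0) => -> | case: (fP v) => _; apply].
Qed.

(** A line spanned by u and v goes onto the point set of some [L'] of rank 2. Since s is injective,
    z is on the first line exactly when [f z] is on [L']; and [L'] is spanned by [f u] and [f v] by
    comparison of ranks. *)
Lemma line_perm_semilinear k (s : {perm point F k.+3}) :
  (forall L : 'M[F]_k.+3, \rank L = 2%N ->
     exists2 L' : 'M[F]_k.+3, \rank L' = 2%N & s @: flat_pts L = flat_pts L') ->
  semilinear_perm s.
Proof.
move=> sL; have [f f0 fs] := perm_vector_lift s.
have fE (v : 'rV[F]_k.+3) (v0 : v != 0) : (f v :=: s (rowV_point v0))%MS.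
  by apply/eqmx_sym/eqmxP/fs/eqmxP; apply: rowV_pointE.
have f_eq0 v : (f v == 0) = (v == 0).
  have [-> | v0] := eqVneq v 0; first by rewrite f0 eqxx.
  by rewrite -mxrank_eq0 (fE v v0) rank_point.
have fP1 v w : (w <= v)%MS = (f w <= f v)%MS.
  have [-> | w0] := eqVneq w 0; first by rewrite f0 !sub0mx.
  have [-> | v0] := eqVneq v 0; first by rewrite f0 !sub_rV0 f_eq0.
  rewrite (fE v v0) (fE w w0) point_subE (inj_eq perm_inj) -point_subE.
  by rewrite !rowV_pointE.
have fP u v w : (w <= u + v)%MS = (f w <= f u + f v)%MS.
  (* Degenerate spans are single points or zero and reduce to [fP1]. *)
  have [uv | uv] := boolP (v <= u)%MS.
    have e : ((u + v)%MS :=: u)%MS by apply/addsmx_idPl.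
    have e' : ((f u + f v)%MS :=: f u)%MS by apply/addsmx_idPl; rewrite -fP1.
    by rewrite e e' fP1.
  have [u0 | u0] := eqVneq u 0.
    by rewrite u0 f0 !adds0mx fP1.
  have [-> | w0] := eqVneq w 0; first by rewrite f0 !sub0mx.
  have v0 : v != 0 by apply: contraNneq uv => ->; apply: sub0mx.
  have [L' rL' eL] := sL <<(u + v)%MS>>%MS
    (etrans (mxrank_gen _) (rank_add_rV u0 uv)).
  have inL' (z : 'rV[F]_k.+3) : z != 0 -> (f z <= L')%MS = (z <= u + v)%MS.
    move=> z0; have : (s (rowV_point z0) \in s @: flat_pts <<(u + v)%MS>>%MS) =
       (z <= u + v)%MS.
      by rewrite (mem_imset _ _ perm_inj) inE rowV_pointE genmxE.
    by rewrite eL inE -fE.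
  rewrite -inL' //; suff -> : ((f u + f v)%MS :=: L')%MS by [].
  apply/eqmxP; rewrite -mxrank_leqif_eq.
    by rewrite rL' rank_add_rV // ?f_eq0 // -fP1.
  by rewrite addsmx_sub !inL' // addsmxSl addsmxSr.
have [theta [A [Au fA]]] := line_map_semilinear f0 fP.
exists theta, A; split=> // x.
rewrite -point_gen; apply/genmxP/eqmxP.
have fx : (s x :=: f (rep_vector x))%MS.
  by apply/eqmxP/fs/eqmxP/eqmx_sym/rep_vectorE.
apply: eqmx_trans fx (eqmx_trans (fA _) _); apply: eqmxMr.
by apply/map_eqmx; apply: rep_vectorE.
Qed.

(** For d = 0 there is a single point and the identity serves; for d = 1 semilinearity is part of
    the definition; for larger d the fundamental theorem applies. *)
Lemma collineation_semilinear d (s : {perm point F d.+1}) :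
  collineation s -> semilinear_perm s.
Proof.
case: d s => [|[|k]] s [sL s2]; last exact: line_perm_semilinear.
  exists idfun, 1%:M; split; first exact: unitmx1.
  move=> x; rewrite map_mx_id // mulmx1.
  rewrite -[LHS]point_gen; congr <<_ : 'M_1>>%MS; congr point_mx.
  apply: point_sub; apply: submx_full.
  by rewrite row_full_unit -row_free_unit /row_free rank_point.
exact: s2.
Qed.

End Collineations.

(** * Automorphisms of designs and transitivity of the full automorphism group *)

Section DesignAutomorphisms.

Variables (T : finType) (t : nat) (D : design_data T).
Implicit Types (g : {perm T}) (Y : {set T}).

Lemma card_imset_setI_le1 (T' : finType) (f : T -> T') (A C : {set T})
    (C' : {set T'}) :
  f @: A :&: C' \subset f @: (A :&: C) ->
  (#|A :&: C| <= 1)%N -> (#|f @: A :&: C'| <= 1)%N.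
Proof.
move=> /subset_leq_card le1 le2.
exact: leq_trans le1 (leq_trans (leq_imset_card _ _) le2).
Qed.

Lemma automorphism_transversal g Y : acts_as_automorphism D g ->
  Y \in transversal_subsets t D -> g @: Y \in transversal_subsets t D.
Proof.
case=> gX _ gC; rewrite !inE => /andP[/andP[sY /forall_inP tY] cY].
rewrite card_imset ?cY ?andbT; last exact: perm_inj.
apply/andP; split; first by rewrite -gX imsetS.
apply/forall_inP => C; rewrite -gC => /imsetP[C0 C0in ->].
by apply: card_imset_setI_le1 (tY _ C0in); rewrite imsetI //; apply: in2W perm_inj.
Qed.

(** Taking images under g is a bijection from the blocks through Y to those through its image.
    Combined with transitivity on transversal t-subsets, this makes the number of blocks through
    such a subset constant. *)
Lemma automorphism_count g Y : acts_as_automorphism D g ->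
  #|[set B in dblocks D | g @: Y \subset B]| =
  #|[set B in dblocks D | Y \subset B]|.
Proof.
case=> _ gB _; have gi : injective (fun B : {set T} => g @: B).
  exact/imset_inj/perm_inj.
rewrite -[RHS](card_imset _ gi); apply: eq_card => B.
rewrite inE -{1}gB; apply/andP/imsetP => [[/imsetP[B0 B0in ->] sYB]|].
  exists B0 => //; rewrite inE B0in; apply/subsetP => x xY.
  have /(subsetP sYB) : g x \in g @: Y by apply: imset_f.
  by rewrite mem_imset //; apply: perm_inj.
move=> [B0]; rewrite inE => /andP[B0in sYB] ->; split; last exact: imsetS.
by apply: imset_f.
Qed.

Lemma full_automorphism_group :
  exists Gam : {group {perm T}},
    forall g, g \in Gam <-> acts_as_automorphism D g.
Proof.
exists ('N(dpts D | 'P) :&: 'N(dblocks D | 'P^*) :&: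
        'N(point_classes D | 'P^*))%G.
have stab (T' : finType) (to : {action {perm T} &-> T'}) (S : {set T'})
    (g : {perm T}) :
    (g \in 'N(S | to)%g) <-> [set to x g | x in S] = S.
  split; first by move/astabs_setact.
  move=> eS; apply/astabsP => x; rewrite -{1}eS.
  exact: (mem_imset S x (act_inj to g)).
move=> g; split=> [/setIP[/setIP[/stab eX /stab eB] /stab eC] // | [eX eB eC]].
by apply/setIP; split; [apply/setIP; split|]; apply/stab.
Qed.

(** Automorphisms may be found pair by pair, since the full group contains them all. Non-emptiness
    is assumed because [[transitive ...]] asks for the orbit of an actual element. *)
Lemma transitive_automorphism_group_ex :
  (exists B, B \in dblocks D) -> (exists Y, Y \in transversal_subsets t D) ->
  {in dblocks D &, forall B B' : {set T},
    exists2 g, acts_as_automorphism D g & g @: B = B'} ->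
  {in transversal_subsets t D &, forall Y Y' : {set T},
    exists2 g, acts_as_automorphism D g & g @: Y = Y'} ->
  exists Gam : {group {perm T}}, transitive_automorphism_group t D Gam.
Proof.
move=> [B0 B0in] [Y0 Y0in] trB trY; have [Gam GamP] := full_automorphism_group.
exists Gam; split; first by move=> g /GamP.
  apply/imsetP; exists B0 => //; apply/setP => B; apply/idP/orbitP => [Bin|[g]].
    by have [g /GamP gG eg] := trB _ _ B0in Bin; exists g.
  by move=> /GamP[_ gB _] <-; rewrite -gB; apply: imset_f.
apply/imsetP; exists Y0 => //; apply/setP => Y; apply/idP/orbitP => [Yin|[g]].
  by have [g /GamP gG eg] := trY _ _ Y0in Yin; exists g.
by move=> /GamP gA <-; apply: (automorphism_transversal gA).
Qed.

End DesignAutomorphisms.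

(** * Coordinates for the points, blocks and classes of the lifting *)

Section LiftedPoints.

Variables (F : finFieldType) (d c : nat).
Local Notation pt := (point F d.+1).
Local Notation lpt := (point F (d.+1 + c)).
Implicit Types (x y : pt) (w : 'rV[F]_c) (M : 'M[F]_(d.+1, c)) (C : {set pt}).

Fact graph_free M : row_free (row_mx 1%:M M).
Proof.
apply/row_freeP; exists (col_mx 1%:M 0).
by rewrite mul_row_col mul1mx mulmx0 addr0.
Qed.

(** The section of the projection determined by M; its image lies in the subspace of all (v, v M), a
    complement of the centre. *)
Definition graph_pt M : pt -> lpt := image_pt (graph_free M).

Fact pt_over_subproof y w : row_mx (rep_vector y) w != 0.
Proof. by rewrite row_mx_eq0 negb_and rep_vector_neq0. Qed.

(** Fixing the first component to the chosen representative of y makes w a genuine coordinate on the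
    fibre over y. *)
Definition pt_over y w : lpt := rowV_point (pt_over_subproof y w).

Lemma graph_ptE M y : graph_pt M y = pt_over y (rep_vector y *m M).
Proof.
apply: point_sub; rewrite rowV_pointE genmxE.
have -> : row_mx (rep_vector y) (rep_vector y *m M) =
          rep_vector y *m row_mx 1%:M M.
  by rewrite mul_mx_row mulmx1.
rewrite submxMfree ?graph_free //.
by rewrite rep_vectorE.
Qed.

Lemma pt_over_graph y w : exists M, pt_over y w = graph_pt M y.
Proof.
(* The row [rep_vector y] is free, so its pseudo-inverse is a right inverse. *)
exists (pinvmx (rep_vector y) *m w); rewrite graph_ptE mulmxA mulmxVp ?mul1mx //.
by rewrite /row_free rank_rV rep_vector_neq0.
Qed.

(** The two vectors are proportional, and the factor is 1 because their first components are the
    same nonzero representative. *)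
Lemma pt_over_inj y w y' w' : pt_over y w = pt_over y' w' -> y = y' /\ w = w'.
Proof.
move=> e; have : (pt_over y w <= pt_over y' w')%MS by rewrite e.
rewrite !rowV_pointE => /sub_rVP[a]; rewrite scale_row_mx => /eq_row_mx[ey ew].
have yy : y = y'.
  by apply: point_sub; rewrite -!rep_vectorE ey scalemx_sub.
split=> //; rewrite ew; move: ey; rewrite yy -[LHS]scale1r => /eqP.
rewrite -subr_eq0 -scalerBl scaler_eq0 (negPf (rep_vector_neq0 _)) orbF subr_eq0.
by move=> /eqP <-; rewrite scale1r.
Qed.

Lemma graph_pt_inj M : injective (graph_pt M).
Proof. by move=> x y; rewrite !graph_ptE => /pt_over_inj[]. Qed.

(** The full preimage of C under the projection, parametrised by pairs so that its size is a
    product. It yields both the point set and the point classes of the lifting. *)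
Definition lift_set C : {set lpt} := [set pt_over p.1 p.2 | p in setX C setT].

Lemma card_lift_set C : #|lift_set C| = (#|C| * #|{: 'rV[F]_c}|)%N.
Proof.
rewrite card_imset => [|[x w] [y w'] /= /pt_over_inj[-> ->]] //.
by rewrite cardsX cardsT.
Qed.

Lemma mem_lift_set C y w : (pt_over y w \in lift_set C) = (y \in C).
Proof.
apply/imsetP/idP => [[[z w'] /=]|yC].
  by rewrite inE /= => /andP[zC _] /pt_over_inj[-> _].
by exists (y, w); rewrite ?inE ?yC.
Qed.

Lemma mem_graph_lift_set C y M : (graph_pt M y \in lift_set C) = (y \in C).
Proof. by rewrite graph_ptE mem_lift_set. Qed.

Lemma lift_setP C (x : lpt) :
  reflect (exists y M, y \in C /\ x = graph_pt M y) (x \in lift_set C).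
Proof.
apply: (iffP imsetP) => [[[y w] /=]|[y [M [yC ->]]]].
  rewrite inE /= => /andP[yC _] ->; have [M eM] := pt_over_graph y w.
  by exists y, M.
by exists (y, rep_vector y *m M); rewrite ?inE ?yC // graph_ptE.
Qed.

Lemma GLact_embed (g : {'GL_(d.+1 + c)[F]}) M y :
  (GLval g : 'M[F]_(d.+1 + c)) = block_mx 1%:M M 0 1%:M ->
  GLact g (embed c y) = graph_pt M y.
Proof.
move=> eg.
have e : row_mx 1%:M M = base_mx F d c *m (GLval g : 'M[F]_(d.+1 + c)).
  by rewrite eg mul_row_block !mul1mx !mul0mx !addr0.
move=> {eg}; apply: point_sub; rewrite /= genmxE genmxE e mulmxA.
by apply: submxMr; rewrite genmxE.
Qed.

Lemma lift_group_ex M : exists2 g : {'GL_(d.+1 + c)[F]},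
  g \in lift_group F d c &
  (GLval g : 'M[F]_(d.+1 + c)) = block_mx 1%:M M 0 1%:M.
Proof.
have U : (block_mx 1%:M M 0 1%:M : 'M[F]_(d.+1 + c)) \is a GRing.unit.
  rewrite -[_ \is a _]/(_ \in unitmx) unitmxE det_ublock !det1 mulr1.
  exact: unitr1.
exists (FinRing.unit _ U) => //.
by rewrite inE; apply/existsP; exists M.
Qed.

Lemma lift_group_form (g : {'GL_(d.+1 + c)[F]}) : g \in lift_group F d c ->
  exists M, (GLval g : 'M[F]_(d.+1 + c)) = block_mx 1%:M M 0 1%:M.
Proof. by rewrite inE => /existsP[M /eqP]; exists M. Qed.

Lemma embedE y : (embed c y :=: row_mx (rep_vector y) (0 : 'rV_c))%MS.
Proof.
have -> : row_mx (rep_vector y) (0 : 'rV_c) = rep_vector y *m base_mx F d c.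
  by rewrite mul_mx_row mulmx1 mulmx0.
by apply: eqmx_trans (genmxE _) (eqmxMr _ (eqmx_sym (rep_vectorE y))).
Qed.

(** Joining with the centre frees the last c coordinates; meeting with the base space then sets them
    to 0. *)
Lemma embed_cap y w :
  (embed c y :=: (pt_over y w + centre_mx F d c) :&: base_mx F d c)%MS.
Proof.
have addE : (pt_over y w + centre_mx F d c :=:
             row_mx (rep_vector y) w + centre_mx F d c)%MS.
  exact: adds_eqmx (rowV_pointE _) (eqmx_refl _).
apply: eqmx_trans (embedE y) _; apply/eqmxP/andP; split.
  rewrite sub_capmx addE; apply/andP; split; last first.
    by apply/submxP; exists (rep_vector y); rewrite mul_mx_row mulmx1 mulmx0.
  apply/sub_addsmxP; exists (1%:M, - w) => /=.
  by rewrite mul1mx mul_mx_row mulmx0 mulmx1 add_row_mx addr0 subrr.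
apply/rV_subP => v; rewrite sub_capmx addE => /andP[/sub_addsmxP[[a b] /= ->]].
case/submxP=> u; rewrite !mul_mx_row !mulmx0 !mulmx1 add_row_mx addr0.
case/eq_row_mx=> eu ->; apply/submxP; exists a.
by rewrite mul_mx_row mulmx0.
Qed.

Lemma projects_pt_over y w z : projects (pt_over y w) z = (z == y).
Proof.
rewrite /projects; apply/idP/eqP => [/eqmxP e|->]; last exact/eqmxP/embed_cap.
have : (embed c z <= embed c y)%MS by rewrite e -embed_cap submx_refl.
rewrite !embedE => /sub_rVP[a]; rewrite scale_row_mx => /eq_row_mx[ez _].
by apply: point_sub; rewrite -!rep_vectorE ez scalemx_sub.
Qed.

Section Lift.

Variable D : design_data pt.

Lemma lift_ptsE : lift_pts c D = lift_set (dpts D).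
Proof.
apply/setP => x; apply/bigcupP/lift_setP =>
    [[y yD /imsetP[g gG ->]]|[y [M [yD ->]]]].
  by have [M eM] := lift_group_form gG; exists y, M; rewrite (GLact_embed _ eM).
have [g gG eg] := lift_group_ex M; exists y => //.
by apply/imsetP; exists g; rewrite ?(GLact_embed _ eg).
Qed.

Lemma lift_blocksP B : reflect
  (exists2 B0, B0 \in dblocks D & exists M, B = graph_pt M @: B0)
  (B \in lift_blocks c D).
Proof.
apply: (iffP imset2P) => [[B0 g B0D gG ->]|[B0 B0D [M ->]]].
  have [M eM] := lift_group_form gG; exists B0 => //; exists M.
  by rewrite -imset_comp; apply: eq_imset => y /=; rewrite (GLact_embed _ eM).
have [g gG eg] := lift_group_ex M; exists B0 g => //.
by rewrite -imset_comp; apply: eq_imset => y /=; rewrite (GLact_embed _ eg).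
Qed.

Lemma lift_relE y w y' w' : y \in dpts D -> y' \in dpts D ->
  lift_rel D (pt_over y w) (pt_over y' w') = drel D y y'.
Proof.
move=> yD y'D; rewrite /lift_rel lift_ptsE !mem_lift_set yD y'D /=.
apply/existsP/idP => [[z /existsP[z']]|yy].
  by rewrite !projects_pt_over => /and3P[/eqP-> /eqP->].
by exists y; apply/existsP; exists y'; rewrite !projects_pt_over !eqxx.
Qed.

(** The lifted relation depends only on projections, so the class of a point over y fills all fibres
    over the class of y. *)
Lemma lift_point_classes :
  point_classes (lifting c D) = lift_set @: point_classes D.
Proof.
have key y w : y \in dpts D ->
    [set x in lift_pts c D | lift_rel D (pt_over y w) x] =
    lift_set [set z in dpts D | drel D y z].
  move=> yD; apply/setP => x; rewrite inE lift_ptsE.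
  apply/andP/imsetP => [[/imsetP[[z w'] /=]]|[[z w'] /=]].
    rewrite inE /= => /andP[zD _] ->; rewrite lift_relE // => yz.
    by exists (z, w') => /=; rewrite ?inE /= ?zD ?yz.
  rewrite !inE /= => /andP[/andP[zD yz] _] ->.
  by rewrite mem_lift_set lift_relE.
apply/setP => C; apply/imsetP/imsetP => [[x]|[C0 /imsetP[y yD ->] ->]].
  rewrite /= lift_ptsE => /imsetP[[y w] /=]; rewrite inE /= => /andP[yD _] -> ->.
  rewrite -lift_ptsE key //; exists [set z in dpts D | drel D y z] => //.
  by apply: imset_f.
exists (pt_over y 0); first by rewrite /= lift_ptsE mem_lift_set.
by rewrite /= -(key _ 0 yD).
Qed.

End Lift.
End LiftedPoints.

(** * Semilinear permutations of points, and interpolation at independent points *)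

Lemma semilinear_point_perm (F : finFieldType) m (theta : {rmorphism F -> F})
    (A : 'M[F]_m) : A \in unitmx ->
  exists s : {perm point F m}, forall x, (s x :=: map_mx theta x *m A)%MS.
Proof.
rewrite -row_free_unit => Afree.
have imP (x : point F m) : is_point <<map_mx theta x *m A>>%MS.
  by rewrite /is_point genmx_id eqxx /= genmxE mxrankMfree // mxrank_map
    rank_point.
pose f x := Point (imP x).
have fE x : (f x :=: map_mx theta x *m A)%MS by exact: genmxE.
have f_inj : injective f.
  move=> x y e; apply: point_sub; rewrite -(map_submx theta).
  by rewrite -(submxMfree _ _ Afree) -!fE e submx_refl.
by exists (perm f_inj) => x; rewrite permE; apply: fE.
Qed.

(** The representatives of the points of Y are the rows of a matrix with a right inverse, so a
    linear map can take prescribed values on them. This places a lift of an independent set on a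
    single section. *)
Lemma independent_interpolation (F : finFieldType) m c (Y : {set point F m})
    (w : point F m -> 'rV[F]_c) : independent Y ->
  exists M : 'M[F]_(m, c), forall y, y \in Y -> rep_vector y *m M = w y.
Proof.
rewrite /independent; set s := enum Y; set X := map _ s => fr.
pose Bm : 'M[F]_(size X, m) := \matrix_i X`_i.
pose W : 'M[F]_(size X, c) := \matrix_i [seq w x | x <- s]`_i.
have Bfree : row_free Bm.
  apply: inj_row_free => u uB; apply/rowP => i; rewrite mxE.
  apply: (@freeP _ _ _ (in_tuple X) fr (u 0)); rewrite -[RHS]uB mulmx_sum_row.
  by apply: eq_bigr => j _; rewrite rowK.
exists (pinvmx Bm *m W) => y yY.
have ys : y \in s by rewrite mem_enum.
have lty : (index y s < size X)%N by rewrite size_map index_mem.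
have -> : rep_vector y = row (Ordinal lty) Bm.
  by rewrite rowK (nth_map y) ?nth_index ?index_mem.
by rewrite -row_mul mulmxA mulmxVp // mul1mx rowK (nth_map y) ?nth_index ?index_mem.
Qed.

(** * Lifting automorphisms, and transversal subsets as parts of sections *)

Section LiftSymmetry.

Variables (F : finFieldType) (d c : nat).
Local Notation pt := (point F d.+1).
Local Notation lpt := (point F (d.+1 + c)).

(** The map (v, w) to (theta(v) A, theta(v) N + theta(w)) sends (v, v M) to (v', v' M') with v' =
    theta(v) A and A M' = theta(M) + N. *)
Lemma semilinear_lift (g : {perm pt}) (M1 M2 : 'M[F]_(d.+1, c)) :
  semilinear_perm g ->
  exists (Phi : {perm lpt}) (mu : 'M[F]_(d.+1, c) -> 'M[F]_(d.+1, c)),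
    mu M1 = M2 /\ forall M y, Phi (graph_pt M y) = graph_pt (mu M) (g y).
Proof.
move=> [theta [A [Au gE]]].
(* Solves A M2 = theta(M1) + N, so that the section of [M1] goes to that of [M2]. *)
pose N := A *m M2 - map_mx theta M1.
pose LA : 'M[F]_(d.+1 + c) := block_mx A N 0 1%:M.
have LAu : LA \in unitmx by rewrite unitmxE det_ublock det1 mulr1 -unitmxE.
have [Phi PhiE] := semilinear_point_perm theta LAu.
exists Phi, (fun M => invmx A *m (map_mx theta M + N)); split.
  by rewrite addrC subrK mulKmx.
move=> M y; apply: point_sub; rewrite PhiE genmxE gE.
rewrite (eqmxMr _ (genmxE _)).
have -> : map_mx theta y *m A *m row_mx 1%:M (invmx A *m (map_mx theta M + N)) =
          map_mx theta (y *m row_mx 1%:M M) *m LA.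
  rewrite map_mxM map_row_mx map_mx1 -!mulmxA; congr (_ *m _).
  by rewrite mul_row_block mul_mx_row mulmx1 !mul1mx mulmx0 addr0 mulmx1
    mulKVmx // addrC.
by apply: submxMr; rewrite map_submx genmxE.
Qed.

Variable D : design_data pt.

(** As [Phi] covers g, it maps preimages into preimages and lifted blocks to lifted blocks;
    injectivity on finite sets turns these inclusions into equalities. *)
Lemma lift_automorphism (g : {perm pt}) (Phi : {perm lpt}) mu :
  acts_as_automorphism D g ->
  (forall M y, Phi (graph_pt M y) = graph_pt (mu M) (g y)) ->
  acts_as_automorphism (lifting c D) Phi.
Proof.
move=> [gX gB gC] PhiE.
have imL C : Phi @: lift_set c C = lift_set c (g @: C).
  apply/eqP; rewrite eqEcard (card_imset _ (@perm_inj _ Phi)).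
  rewrite !card_lift_set (card_imset _ (@perm_inj _ g)) leqnn andbT.
  apply/subsetP => _ /imsetP[_ /lift_setP[y [M [yC ->]]] ->].
  by rewrite PhiE mem_graph_lift_set imset_f.
split=> /=.
- by rewrite lift_ptsE imL gX.
- have Phi_inj : injective (fun B : {set lpt} => Phi @: B).
    exact/imset_inj/perm_inj.
  apply/eqP; rewrite eqEcard (card_imset _ Phi_inj) leqnn andbT.
  apply/subsetP => _ /imsetP[_ /lift_blocksP[B0 B0D [M ->]] ->].
  apply/lift_blocksP; exists (g @: B0); first by rewrite -gB imset_f.
  by exists (mu M); rewrite -!imset_comp; apply: eq_imset => y /=.
- rewrite lift_point_classes -[in RHS]gC -!imset_comp.
  by apply: eq_imset => C /=; rewrite imL.
Qed.

Lemma graph_transversal M Y :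
  rho_transversal D Y -> rho_transversal (lifting c D) (graph_pt M @: Y).
Proof.
case/andP=> sY /forall_inP tY; apply/andP; split.
  apply/subsetP => _ /imsetP[y yY ->] /=.
  by rewrite lift_ptsE mem_graph_lift_set (subsetP sY).
rewrite lift_point_classes; apply/forall_inP => _ /imsetP[C CD ->].
apply: card_imset_setI_le1 (tY _ CD); apply/subsetP => x /setIP[/imsetP[y yY ->]].
by rewrite mem_graph_lift_set => yC; rewrite imset_f // inE yY.
Qed.

Lemma graph_transversal_subset t M Y : Y \in transversal_subsets t D ->
  graph_pt M @: Y \in transversal_subsets t (lifting c D).
Proof.
rewrite !inE => /andP[tY cY].
by rewrite graph_transversal //= card_imset //; apply: graph_pt_inj.
Qed.

(** Projection is injective on Y and its image [Y0] is again a transversal t-subset, hence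
    independent; interpolating the fibre coordinates over [Y0] gives M. *)
Lemma transversal_subset_graph t Y :
  {in dpts D & &, equivalence_rel (drel D)} ->
  (forall Y, Y \in transversal_subsets t D -> independent Y) ->
  Y \in transversal_subsets t (lifting c D) ->
  exists2 Y0, Y0 \in transversal_subsets t D & exists M, Y = graph_pt M @: Y0.
Proof.
move=> eqD indep; rewrite inE => /andP[/andP[/= sY /forall_inP tY] /eqP cY].
have [yw ywP] : exists yw : lpt -> pt * 'rV[F]_c,
    forall x, x \in Y -> (yw x).1 \in dpts D /\ x = pt_over (yw x).1 (yw x).2.
  apply: (@fin_all_exists _ _ (fun x p => x \in Y ->
            p.1 \in dpts D /\ x = pt_over p.1 p.2)) => x.
  have [xY|xY] := boolP (x \in Y); last first.
    (* Outside Y an arbitrary point serves as default value, since the choice function must be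
       total. *)
    have v0 : delta_mx 0 0 != 0 :> 'rV[F]_d.+1.
      by apply/eqP => /matrixP/(_ 0 0)/eqP; rewrite !mxE !eqxx oner_eq0.
    by exists (rowV_point v0, 0).
  have := subsetP sY x xY; rewrite lift_ptsE => /imsetP[[y w] /=].
  by rewrite inE /= => /andP[yD _] ->; exists (y, w).
(* Points of Y projecting into one class lie in the same lifted class, which meets Y at most
   once. *)
have same C x x' : C \in point_classes D -> x \in Y -> x' \in Y ->
    (yw x).1 \in C -> (yw x').1 \in C -> x = x'.
  move=> CD xY x'Y xC x'C; have LD : lift_set c C \in point_classes (lifting c D).
    by rewrite lift_point_classes imset_f.
  have inL z : z \in Y -> (yw z).1 \in C -> z \in lift_set c C.
    by move=> zY zC; have [_ ->] := ywP z zY; rewrite mem_lift_set.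
  by apply: (card_le1_eqP (tY _ LD)); rewrite inE ?xY ?x'Y inL.
have class_of y : y \in dpts D -> exists2 C, C \in point_classes D & y \in C.
  move=> yD; exists [set z in dpts D | drel D y z]; first exact: imset_f.
  by rewrite inE yD; case: (eqD y y y yD yD yD).
have y_inj : {in Y &, injective (fun x => (yw x).1)}.
  move=> x x' xY x'Y /= e; have [C CD xC] := class_of _ (proj1 (ywP _ xY)).
  by apply: (same C) => //; rewrite -e.
pose Y0 := [set (yw x).1 | x in Y].
have Y0t : Y0 \in transversal_subsets t D.
  rewrite inE card_in_imset ?cY ?eqxx ?andbT //; apply/andP; split.
    by apply/subsetP => _ /imsetP[x xY ->]; case: (ywP x xY).
  apply/forall_inP => C CD; apply/card_le1_eqP => y y'.
  move=> /setIP[/imsetP[x xY ->] xC] /setIP[/imsetP[x' x'Y ->] x'C].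
  by rewrite (same C x x').
(* Injectivity of the projection on Y makes the fibre coordinate a function of the projected point;
   it is 0 off [Y0]. *)
have [w wP] : exists w : pt -> 'rV[F]_c,
    forall x, x \in Y -> w (yw x).1 = (yw x).2.
  exists (fun y => if [pick x in Y | (yw x).1 == y] is Some x
                   then (yw x).2 else 0).
  move=> x xY; case: pickP => [x' /andP[x'Y /eqP e]|/(_ x)]; last first.
    by rewrite xY eqxx.
  by rewrite (y_inj _ _ x'Y xY e).
have [M MP] := independent_interpolation w (indep _ Y0t).
exists Y0 => //; exists M; rewrite -imset_comp -[LHS]imset_id.
apply: eq_in_imset => x xY /=.
have yY0 : (yw x).1 \in Y0 by apply/imsetP; exists x.
by rewrite graph_ptE (MP _ yY0) (wP _ xY); case: (ywP x xY).
Qed.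

End LiftSymmetry.

Theorem theorem3p4 (F : finFieldType) (t d c beta : nat)
    (Dbar : design_data (point F d.+1))
    (hdesign : is_divisible_design t Dbar)
    (hgen : row_full (span_pts (dpts Dbar)))
    (hindep : forall Y, Y \in transversal_subsets t Dbar -> independent Y)
    (hbeta : forall B, B \in dblocks Dbar -> \rank (span_pts B) = beta)
    (Gambar : {group {perm point F d.+1}})
    (hcoll : {in Gambar, forall g, collineation g})
    (haut : transitive_automorphism_group t Dbar Gambar) :
  obtainable_by_Spera t (lifting c Dbar).
Proof.
case: hdesign => s [k [l [eqD t0 s0 k0 l0 blkD clsD lamD tle]]].
case: haut => autD trB trY.
have [B0 B0D _] := imsetP trB; have [Y0 Y0D _] := imsetP trY.
have lift_aut g M1 M2 : g \in Gambar -> exists2 Phi : {perm point F (d.+1 + c)},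
    acts_as_automorphism (lifting c Dbar) Phi &
    forall Z : {set point F d.+1},
      Phi @: (graph_pt M1 @: Z) = graph_pt M2 @: (g @: Z).
  move=> gG; have := semilinear_lift M1 M2 (collineation_semilinear (hcoll g gG)).
  move=> [Phi [mu [muM PhiE]]]; exists Phi.
    exact: lift_automorphism (autD g gG) PhiE.
  by move=> Z; rewrite -!imset_comp; apply: eq_imset => y /=; rewrite PhiE muM.
(* Both subsets lie on sections over transversal t-subsets of the base; an element of [Gambar] joins
   the latter, and its lift is chosen to carry one section to the other. *)
have transY : {in transversal_subsets t (lifting c Dbar) &,
    forall Y Y' : {set point F (d.+1 + c)},
    exists2 g, acts_as_automorphism (lifting c Dbar) g & g @: Y = Y'}.
  move=> Y Y' /(transversal_subset_graph eqD hindep)[Z Zt [M ->]].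
  move=> /(transversal_subset_graph eqD hindep)[Z' Zt' [M' ->]].
  have [g gG ->] := atransP2 trY Zt Zt'.
  by have [Phi PhiA PhiE] := lift_aut g M M' gG; exists Phi; last exact: PhiE.
split; last first.
  apply: transitive_automorphism_group_ex transY.
  - by exists (graph_pt 0 @: B0); apply/lift_blocksP; exists B0 => //; exists 0.
  - by exists (graph_pt 0 @: Y0); apply: graph_transversal_subset.
  move=> _ _ /lift_blocksP[Z Zt [M ->]] /lift_blocksP[Z' Zt' [M' ->]].
  have [g gG ->] := atransP2 trB Zt Zt'.
  by have [Phi PhiA PhiE] := lift_aut g M M' gG; exists Phi; last exact: PhiE.
have q0 : (0 < #|{: 'rV[F]_c}|)%N by apply/card_gt0P; exists 0.
pose Y1 : {set point F (d.+1 + c)} := graph_pt 0 @: Y0.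
have Y1t : Y1 \in transversal_subsets t (lifting c Dbar).
  exact: graph_transversal_subset.
(* Each fibre has q^c points, which multiplies the class size; sections are injective, so the block
   size stays k. The third parameter is the count at the reference subset [Y1], carried to every
   other subset by [transY]. *)
exists (s * #|{: 'rV[F]_c}|)%N, k,
  #|[set B in dblocks (lifting c Dbar) | Y1 \subset B]|; split=> //.
- rewrite /= lift_ptsE => x y z.
  case/imsetP=> [[x0 wx]] /=; rewrite inE /= => /andP[xD _] ->.
  case/imsetP=> [[y0 wy]] /=; rewrite inE /= => /andP[yD _] ->.
  case/imsetP=> [[z0 wz]] /=; rewrite inE /= => /andP[zD _] ->.
  by rewrite !lift_relE //; apply: eqD.
- by rewrite muln_gt0 s0.
(* A block through [Y0] lifts along the zero section to a block through [Y1]. *)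
- have : (0 < #|[set B in dblocks Dbar | Y0 \subset B]|)%N by rewrite lamD.
  case/card_gt0P=> B; rewrite inE => /andP[BD sYB]; apply/card_gt0P.
  exists (graph_pt 0 @: B); rewrite inE imsetS // andbT.
  by apply/lift_blocksP; exists B => //; exists 0.
- move=> _ /lift_blocksP[B BD [M ->]]; have [tB cB] := blkD _ BD.
  split; first exact: graph_transversal.
  by rewrite card_imset //; apply: graph_pt_inj.
- by rewrite lift_point_classes => _ /imsetP[C CD ->]; rewrite card_lift_set clsD.
- by move=> Y /(transY _ _ Y1t)[g gA <-]; apply: automorphism_count.
(* The factor q^c cancels in the quotient of the number of points by the class size. *)
- by rewrite /= lift_ptsE card_lift_set divnMr.
Qed.
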